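(* Let $(X,d)$ be a metric space, and let $U(X)$ be the set of real-valued uniformly continuous functions on $X$. Suppose there exists a Bourbaki-bounded subset $F\subset X$ such that $X\setminus F^{\gamma}$ is uniformly isolated for every $\gamma>0$, where $F^{\gamma}=\{x\in X: d(x,F)\leq\gamma\}$. Then $U(X)$ is a ring (under pointwise addition and multiplication).
   Context: Let $(X,d)$ be a metric space. $U(X)$ denotes the set of all uniformly continuous functions $f:X\to\mathbb{R}$; saying that $U(X)$ is a ring refers to the pointwise operations, i.e. it means that the pointwise product of any two functions in $U(X)$ is again in $U(X)$. A subset $F\subset X$ is a Bourbaki-bounded subset of $X$ if for every $f\in U(X)$ the restriction $f|_F:F\to\mathbb{R}$ is bounded. For $F\subset X$ and $x\in X$, $d(x,F)=\inf\{d(x,y):y\in F\}$, with the convention $\inf\emptyset=+\infty$. For $x\in X$, the isolation index is $I(x)=d(x,X\setminus\{x\})=\inf\{d(x,y): y\in X,\ y\neq x\}$. A subset $A\subset X$ is uniformly isolated (in $X$) if $\inf\{I(a): a\in A\}>0$, again with the convention $\inf\emptyset=+\infty$. Equivalently, there is $\varepsilon>0$ such that $d(a,x)\geq\varepsilon$ for every $a\in A$ and every $x\in X$ with $x\neq a$. *)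

(* Defs.v *)
From HB Require Import structures.
From mathcomp Require Import all_boot all_order all_algebra.
From mathcomp Require Import all_classical all_reals all_analysis.

Set Implicit Arguments.
Unset Strict Implicit.
Unset Printing Implicit Defensive.

Import Order.TTheory GRing.Theory Num.Theory.
Import numFieldNormedType.Exports.

Local Open Scope classical_set_scope.
Local Open Scope ring_scope.

Section bourbaki.
Context {R : realType} {X : metricType R}.
Implicit Types (x : X) (A F : set X).

(* U(X) *)
Definition ucfun : {pred X -> R} := mem [set f : X -> R | unif_continuous f].

Definition bourbaki_bounded F : Prop :=
  forall f : X -> R, f \in ucfun -> [bounded f x | x in F].

(* Values are taken in \bar R, where the infimum of the empty set is +oo. *)
Definition dist_to x F : \bar R := ereal_inf [set (mdist x y)%:E | y in F].

Definition enlargement F (g : R) : set X :=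
  [set x | (dist_to x F <= g%:E)%E].

Definition isolation_index x : \bar R := dist_to x [set~ x].

Definition uniformly_isolated A : Prop :=
  (0 < ereal_inf [set isolation_index a | a in A])%E.

End bourbaki.

Arguments ucfun {R} X.

(* Main.v *)
Require Import Defs.
From HB Require Import structures.
From mathcomp Require Import all_boot all_order all_algebra.
From mathcomp Require Import all_classical all_reals all_analysis.
From mathcomp Require Import ring lra.

Set Implicit Arguments.
Unset Strict Implicit.
Unset Printing Implicit Defensive.

Import Order.TTheory GRing.Theory Num.Theory.
Import numFieldNormedType.Exports.

Local Open Scope classical_set_scope.
Local Open Scope ring_scope.

(** Uniformly continuous functions [f] and [g] are bounded on a small enlargement
    of [F], so around its points [f * g] satisfies the usual estimate for a product
    of bounded functions. A point outside the enlargement has no other point within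
    some fixed distance, so nothing has to be checked there. *)

Lemma ucfunP (R : realType) (X : metricType R) (f : X -> R) :
  f \in ucfun X <-> forall e, 0 < e ->
    exists2 d, 0 < d & forall x y, mdist x y < d -> `|f x - f y| < e.
Proof.
have -> : f \in ucfun X <-> unif_continuous f.
  by rewrite /ucfun; split=> [/set_mem|/mem_set].
rewrite (@unif_continuousP R X R f).
split => h e e0; have [d d0 hd] := h e e0; exists d => //.
- move=> x y xy; have := hd (x, y).
  by rewrite /= -ball_normE /= ballEmdist; apply.
- move=> [x y] /=; rewrite -ball_normE /= ballEmdist; exact: hd.
Qed.

(** With tolerance 1 in uniform continuity, a point close enough to [F] has a value within 1 of one
    taken on [F], where [f] is bounded. *)
Lemma bourbaki_bounded_enlargement (R : realType) (X : metricType R)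
    (F : set X) (f : X -> R) :
  bourbaki_bounded F -> f \in ucfun X ->
  exists2 r : R, 0 < r & exists M : R, forall x, enlargement F r x -> `|f x| <= M.
Proof.
(* Boundedness gives a threshold [A] such that every number above it bounds [f] on [F]; [A + 1] is
   one. *)
move=> bF uf; have [A [_ /(_ (A + 1))]] := bF f uf.
rewrite ltrDl ltr01 => /(_ isT) fF.
have [d d0 hd] := (ucfunP f).1 uf 1 ltr01.
(* The infimum [dist_to x F] need not be attained; halving [d] puts it strictly below [d], which
   yields a point of [F] within [d] of [x]. *)
exists (d / 2); first by rewrite divr_gt0.
exists (A + 1 + 1) => x xF.
have /ereal_inf_lt[_ [y Fy <-]] : (dist_to x F < d%:E)%E.
  by apply: (le_lt_trans xF); rewrite lte_fin; lra.
rewrite lte_fin => xy.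
have /= fy := fF y Fy.
have := hd _ _ xy; have := ler_normD (f x - f y) (f y); rewrite subrK; lra.
Qed.

Lemma enlargementS (R : realType) (X : metricType R) (F : set X) (r s : R) :
  r <= s -> enlargement F r `<=` enlargement F s.
Proof. by move=> rs x /le_trans; apply; rewrite lee_fin. Qed.

Lemma uniformly_isolatedP (R : realType) (X : metricType R) (A : set X) :
  uniformly_isolated A ->
  exists2 r : R, 0 < r & forall x y, A x -> mdist x y < r -> x = y.
Proof.
move=> iA.
have [r r0 rA] : exists2 r : R, 0 < r &
    (r%:E <= ereal_inf [set isolation_index a | a in A])%E.
  move: iA; rewrite /uniformly_isolated.
  (* The infimum may be [+oo], for instance when [A] is empty; then any positive radius works. *)
  case: ereal_inf => [r|_|//]; last by exists 1; rewrite ?ltr01 ?leey.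
  by rewrite lte_fin => r0; exists r.
exists r => // x y Ax xy; apply: contrapT => nxy.
have : (r%:E <= (mdist x y)%:E)%E.
  apply: (le_trans rA); apply: (@le_trans _ _ (isolation_index x)).
    by apply: ereal_inf_lbound; exists x.
  by apply: ereal_inf_lbound; exists y => //= yx; exact/nxy/esym.
by rewrite lee_fin leNgt xy.
Qed.

(** Expanding around [(a, b)] leaves a quadratic term, at most [e] since [e <= 1]. Only [a] and [b]
    need bounds, so the second point may lie outside the enlargement. *)
Lemma ler_dist_mul (R : realDomainType) (a b a' b' M e : R) :
  `|a| <= M -> `|b| <= M -> e <= 1 -> `|a - a'| < e -> `|b - b'| < e ->
  `|a * b - a' * b'| <= (2 * M + 1) * e.
Proof.
move=> aM bM e1 aa bb.
have -> : a * b - a' * b' =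
    (a - a') * b + a * (b - b') - (a - a') * (b - b') by ring.
apply: (le_trans (ler_normB _ _)); apply: (le_trans (lerD (ler_normD _ _) (lexx _))).
rewrite !normrM.
have := ler_pM (normr_ge0 _) (normr_ge0 _) (ltW aa) bM.
have := ler_pM (normr_ge0 _) (normr_ge0 _) aM (ltW bb).
have := ler_pM (normr_ge0 _) (normr_ge0 _) (le_trans (ltW aa) e1) (ltW bb).
lra.
Qed.

Theorem corollary2p6 (R : realType) (X : metricType R)
  (hX : exists F : set X, bourbaki_bounded F /\
    forall gamma : R, 0 < gamma ->
      uniformly_isolated (~` enlargement F gamma)) :
  subring_closed (ucfun X).
Proof.
have [F [bF iF]] := hX; split.
- by apply/ucfunP => e e0; exists 1 => // x y _; rewrite /= subrr normr0.
- move=> f g /ucfunP uf /ucfunP ug; apply/ucfunP => e e0.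
  have e2 : 0 < e / 2 by rewrite divr_gt0.
  have [df df0 hf] := uf _ e2; have [dg dg0 hg] := ug _ e2.
  exists (Num.min df dg) => [|x y]; first by rewrite lt_min df0.
  rewrite lt_min => /andP[/hf fxy /hg gxy].
  have -> : (f - g) x - (f - g) y = (f x - f y) - (g x - g y).
    by rewrite !fctE; ring.
  by apply: (le_lt_trans (ler_normB _ _)); lra.
- move=> f g uf ug; apply/ucfunP => e e0.
  have [rf rf0 [Mf hMf]] := bourbaki_bounded_enlargement bF uf.
  have [rg rg0 [Mg hMg]] := bourbaki_bounded_enlargement bF ug.
  have [|s s0 hs] := @uniformly_isolatedP _ _ _ (iF (Num.min rf rg) _).
    by rewrite lt_min rf0.
  (* If the enlargement is empty, [Mf] and [Mg] may be negative; the 0 keeps [2 * M + 1]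
     positive. *)
  pose M := Num.max 0 (Num.max Mf Mg).
  have M0 : 0 <= M by rewrite le_max lexx.
  (* The 1 meets the condition [e <= 1] of [ler_dist_mul]; halving [e] makes the final estimate
     strict. *)
  pose a := Num.min 1 (e / 2 / (2 * M + 1)).
  have M1 : 0 < 2 * M + 1 by lra.
  have a0 : 0 < a by rewrite lt_min ltr01 !divr_gt0.
  have Mae : (2 * M + 1) * a < e.
    apply: (@le_lt_trans _ _ (e / 2)); last by lra.
    by rewrite mulrC -ler_pdivlMr // ge_min lexx orbT.
  have [df df0 hf] := (ucfunP f).1 uf a a0.
  have [dg dg0 hg] := (ucfunP g).1 ug a a0.
  (* [s] forces [x = y] when [x] is outside the enlargement; [df] and [dg] serve when it is
     inside. *)
  exists (Num.min s (Num.min df dg)) => [|x y]; first by rewrite !lt_min s0 df0.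
  rewrite !lt_min => /and3P[xys /hf fxy /hg gxy].
  have [xF|xF] := pselect (enlargement F (Num.min rf rg) x); last first.
    by rewrite (hs _ _ xF xys) subrr normr0.
  have fM : `|f x| <= M.
    rewrite !le_max (hMf x) ?orbT //.
    by apply: enlargementS xF; rewrite ge_min lexx.
  have gM : `|g x| <= M.
    rewrite !le_max (hMg x) ?orbT //.
    by apply: enlargementS xF; rewrite ge_min lexx orbT.
  apply: le_lt_trans Mae; apply: ler_dist_mul => //.
  by rewrite ge_min lexx.
Qed.
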